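(* Let $n \ge 1$ be an integer and let $B_1, B_2, \ldots$ be independent fair coin flips (each uniform on $\{0,1\}$). Consider the algorithm $\textsf{optimal\_uniform}(n)$: (1) set $m \leftarrow 1$, $X \leftarrow 1$; (2) while $m < n$: (3) draw the next fair coin flip $B$; (4) set $X \leftarrow X + Bm$ and $m \leftarrow 2m$; (5) if $m \ge n$ and $X \le n$ then set $m \leftarrow n$; (6) if $m \ge n$ and $X > n$ then set $X \leftarrow X - n$ and $m \leftarrow m - n$; (7) return $X$. Then the output of $\textsf{optimal\_uniform}(n)$ is uniformly distributed over $\{1, \ldots, n\}$. *)

(* Defs.v *)
From HB Require Import structures.
From mathcomp Require Import all_boot all_order all_algebra.
From mathcomp Require Import all_classical all_reals all_analysis.

Set Implicit Arguments.
Unset Strict Implicit.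
Unset Printing Implicit Defensive.

Import Order.TTheory GRing.Theory Num.Theory.

Local Open Scope classical_set_scope.
Local Open Scope ring_scope.

Definition mutually_independent d d' (T : measurableType d)
    (T' : measurableType d') (R : realType) (P : probability T R) (I : eqType)
    (X : I -> {RV P >-> T'}) : Prop :=
  forall (s : seq I) (A : I -> set T'),
    uniq s -> (forall i, measurable (A i)) ->
    P (\bigcap_(i in [set` s]) (X i @^-1` A i)) =
    (\prod_(i <- s) P (X i @^-1` A i))%E.

Local Open Scope nat_scope.

(* One pass through the loop: the state is (m, X) and b is the flip just drawn,
   false and true standing for 0 and 1. *)
Definition loop_body (n : nat) (b : bool) (st : nat * nat) : nat * nat :=
  let: (m, X) := st in
  let X := X + b * m in
  let m := 2 * m in
  let m := if (n <= m) && (X <= n) then n else m in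
  if (n <= m) && (n < X) then (m - n, X - n) else (m, X).

(* [while_loop n b t st k]: the loop entered in state st, when the next flip to
   be drawn is b t, halts after finitely many passes and k is returned.  No k
   is related to a diverging execution. *)
Inductive while_loop (n : nat) (b : nat -> bool) :
    nat -> nat * nat -> nat -> Prop :=
| while_exit t m X : ~~ (m < n) -> while_loop n b t (m, X) X
| while_pass t m X k : m < n ->
    while_loop n b t.+1 (loop_body n (b t) (m, X)) k ->
    while_loop n b t (m, X) k.

(* The flips are indexed from 0: b 0 is the first one. *)
Definition optimal_uniform_returns (n : nat) (b : nat -> bool) (k : nat) : Prop :=
  while_loop n b 0 (1, 1) k.

(* Main.v *)
(* Write r = 2^t mod n.  After t flips the loop has either halted with some k in
   {1, ..., n}, or it sits in a state (r, x) with 1 <= x <= r, and each such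
   state is reached by exactly one string of t flips.  When 2 r >= n, each k is
   returned by exactly one more string at the next pass, and
   floor(2^(t+1) / n) = 2 floor(2^t / n) + [2 r >= n].  So, of the 2^t strings
   of length t, exactly floor(2^t / n) have returned k, and
   floor(2^t / n) / 2^t tends to 1 / n. *)

Require Import Defs.
From HB Require Import structures.
From mathcomp Require Import all_boot all_order all_algebra.
From mathcomp Require Import all_classical all_reals all_analysis.
From mathcomp Require Import zify ring.

Set Implicit Arguments.
Unset Strict Implicit.
Unset Printing Implicit Defensive.

Import Order.TTheory GRing.Theory Num.Theory numFieldNormedType.Exports.
Local Open Scope classical_set_scope.
Local Open Scope ring_scope.

(** * Quotient and remainder of [2 ^ t] by [n] under doubling *)

Lemma expn2S_divmod (n t : nat) : (0 < n)%N ->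
  let r := (2 ^ t %% n)%N in
  (2 ^ t.+1 %/ n = 2 * (2 ^ t %/ n) + (n <= 2 * r))%N /\
  (2 ^ t.+1 %% n = if n <= 2 * r then 2 * r - n else 2 * r)%N.
Proof.
move=> n_gt0 r; have r_lt : (r < n)%N by rewrite ltn_mod.
have -> : (2 ^ t.+1 = 2 * (2 ^ t %/ n) * n + 2 * r)%N.
  by rewrite expnS {1}(divn_eq (2 ^ t) n) mulnDr mulnA.
have: ((2 * r) %/ n = (n <= 2 * r))%N /\
      ((2 * r) %% n = if (n <= 2 * r) then 2 * r - n else 2 * r)%N.
  have [n_le|lt_n] := leqP n (2 * r); last by rewrite divn_small ?modn_small.
  have lt_n : (2 * r - n < n)%N by lia.
  rewrite -{1 2}(subnK n_le) modnDr modn_small //.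
  by rewrite divnDr ?dvdnn // divnn n_gt0 divn_small.
by rewrite divnMDl // modnMDl => -[-> ->].
Qed.

(** * The loop as a total iteration on states *)

(** Halted states are made fixed points, so that the state after [t] flips exists for every [t],
    whether or not the loop has halted. *)
Definition step (n : nat) (b : bool) (st : nat * nat) : nat * nat :=
  if (st.1 < n)%N then loop_body n b st else st.

Fixpoint run (n : nat) (b : nat -> bool) (t : nat) : nat * nat :=
  if t is u.+1 then step n (b u) (run n b u) else (1, 1)%N.

Lemma step_live (n m x : nat) (b : bool) : (m < n)%N -> (x <= m)%N ->
  step n b (m, x) =
  (if n <= 2 * m
   then if x + b * m <= n then (n, x + b * m) else (2 * m - n, x + b * m - n)
   else (2 * m, x + b * m))%N.
Proof.
move=> mn xm; rewrite /step /loop_body /= mn.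
case: (leqP n (2 * m)) => h2 /=; last by rewrite leqNgt h2.
by case: (leqP (x + b * m) n) => h /=; rewrite ?leqnn ?h2 //=.
Qed.

Lemma step_halted (n x : nat) (b : bool) : step n b (n, x) = (n, x).
Proof. by rewrite /step /= ltnn. Qed.

(** The loop invariant. If [n] divides [2 ^ t], the range of [x] in [RunLive] is empty, so every run
    has halted by then. *)
Variant run_spec (n t : nat) : nat * nat -> Type :=
| RunHalted k of (1 <= k <= n)%N : run_spec n t (n, k)
| RunLive x of (1 <= x <= 2 ^ t %% n)%N : run_spec n t (2 ^ t %% n, x)%N.

Lemma runP (n : nat) (b : nat -> bool) (t : nat) :
  (0 < n)%N -> run_spec n t (run n b t).
Proof.
move=> n0; elim: t => [|t IH] /=.
  (* For [n = 1] the initial state is already halted; for larger [n] its first component 1 is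
     [2 ^ 0 %% n]. *)
  case: n n0 => [|[|n]] // _; first exact: RunHalted.
  rewrite -[X in (X, _)](@modn_small 1 n.+2) //.
  by apply: RunLive; rewrite expn0 modn_small.
case: IH => [k hk|x /andP[x0 xr]]; first by rewrite step_halted; exact: RunHalted.
have rn : (2 ^ t %% n < n)%N by rewrite ltn_mod.
have [_ Em] := expn2S_divmod t n0.
rewrite step_live //; case: leqP Em => h2 Em.
  case: leqP => hx; first by apply: RunHalted; lia.
  by rewrite -Em; apply: RunLive; rewrite Em; case: (b t) hx; lia.
by rewrite -Em; apply: RunLive; rewrite Em; case: (b t); lia.
Qed.

Lemma while_loop_run (n : nat) (b : nat -> bool) (t : nat) st (k : nat) :
  while_loop n b t st k -> st = run n b t ->
  exists u, (n <= (run n b u).1)%N /\ (run n b u).2 = k.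
Proof.
elim=> {t st k} [t m X h E|t m X k h _ IH E].
  by exists t; rewrite -E /= leqNgt.
by apply: IH; rewrite /= -E /step /= h.
Qed.

Lemma run_while_loop (n : nat) (b : nat -> bool) (j t : nat) :
  (n <= (run n b (t + j)).1)%N ->
  while_loop n b t (run n b t) (run n b (t + j)).2.
Proof.
elim: j t => [|j IH] t.
  by rewrite addn0; case: run => m X h; apply: while_exit; rewrite -leqNgt.
rewrite addnS -addSn => /IH; case E: (run n b t) => [m X].
case: (ltnP m n) => h; first by rewrite /= E /step /= h; exact: while_pass.
have stable i : run n b (t + i) = (m, X).
  by elim: i => [|i IHi]; rewrite ?addn0 // addnS /= IHi /step /= ltnNge h.
by move=> _; rewrite addSn -addnS stable; apply: while_exit; rewrite -leqNgt.
Qed.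

(** The exit test only gives [n <= m]; the invariant sharpens it to [m = n], since a live [m] is a
    remainder modulo [n]. *)
Lemma returns_run (n : nat) (b : nat -> bool) (k : nat) : (0 < n)%N ->
  optimal_uniform_returns n b k <-> exists t, run n b t = (n, k).
Proof.
move=> n0; split=> [/while_loop_run/(_ erefl)[t]|[t E]].
  case E: (run n b t) / (runP b t n0) => [k' _|x _] /= [+ <-]; first by exists t.
  by rewrite leqNgt ltn_mod n0.
by have := @run_while_loop n b t 0; rewrite add0n E; exact.
Qed.

Lemma run_haltedW (n : nat) (b : nat -> bool) (t u k : nat) :
  (t <= u)%N -> run n b t = (n, k) -> run n b u = (n, k).
Proof.
move=> /subnKC <- E; elim: (u - t)%N => [|j IH]; first by rewrite addn0.
by rewrite addnS /= IH step_halted.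
Qed.

(** * Flip strings leading to a given state *)

(** A string of [t] flips is encoded as a function [c], of which only the values below [t] count. *)
Lemma cylinder_extend (t : nat) (c : nat -> bool) (v : bool) :
  exists c' : nat -> bool, forall b : nat -> bool,
    ((forall i, (i < t)%N -> b i = c i) /\ b t = v) <->
    (forall i, (i < t.+1)%N -> b i = c' i).
Proof.
exists (fun i => if i == t then v else c i) => b; split=> [[bc bt] i|bc'].
  by rewrite ltnS leq_eqVlt; case: eqP => [-> //|_ /bc].
split=> [i it|]; last by rewrite bc' // eqxx.
by rewrite bc' ?(leqW it) // ltn_eqF.
Qed.

Lemma run_live_cylinder (n t x : nat) : (1 <= x <= 2 ^ t %% n)%N -> (0 < n)%N ->
  exists c : nat -> bool, forall b : nat -> bool,
    run n b t = (2 ^ t %% n, x)%N <-> (forall i, (i < t)%N -> b i = c i).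
Proof.
move=> + n0; elim: t x => [|t IH] x.
  case: n n0 => [|[|n]] // _; rewrite ?modn1 ?expn0 ?modn_small //; first by case: x.
  by case: x => [|[|x]] // _; exists xpred0.
have [_ Em] := expn2S_divmod t n0; move=> hx.
have rn : (2 ^ t %% n < n)%N by rewrite ltn_mod.
set r := (2 ^ t %% n)%N in IH Em rn.
have Smn : (2 ^ t.+1 %% n < n)%N by rewrite ltn_mod.
(* The last pass is inverted: [v] is the only possible flip and [(r, y)] the only possible previous
   state. If [n <= 2 * r], staying live needs [y + v * r = x + n], which exceeds [r] and forces [v]
   to be true. Otherwise [x = y + v * r] with [1 <= y <= r], so [v] tells whether [x] exceeds
   [r]. *)
pose v := if (n <= 2 * r)%N then true else (r < x)%N.
pose y := (if n <= 2 * r then x + n - r else if r < x then x - r else x)%N.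
have [|c Hc] := IH y; first by move: hx; rewrite /y Em; do 2?case: ifP; lia.
have [c' Hc'] := cylinder_extend t c v.
exists c' => b; rewrite -Hc' -Hc /=.
case: (runP b t n0) => [k hk|z hz].
  by rewrite step_halted; split=> [|[]] [] *; lia.
rewrite step_live //; last by case/andP: hz.
rewrite -/r in hz *; rewrite Em in hx Smn *; rewrite /v /y.
move: hz hx Smn; case: (b t); case: (leqP n (2 * r)) => h2 hz hx Smn;
  rewrite ?mul1n ?mul0n ?addn0;
  do ?[case: leqP => ?]; split=> [[]|[[]]] *; try split; try congr pair; lia.
Qed.

(** With [r = 2 ^ t %% n], the bound [k <= n <= 2 * r] gives a unique decomposition [k = y + v * r]
    with [1 <= y <= r] and [v] a bit, hence a unique last live state and last flip. Excluding
    [run n b t = (n, k)] discards the strings that had returned [k] earlier. *)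
Lemma run_halts_cylinder (n t k : nat) : (1 <= k <= n)%N ->
  (n <= 2 * (2 ^ t %% n))%N ->
  exists c : nat -> bool, forall b : nat -> bool,
    (run n b t.+1 = (n, k) /\ run n b t <> (n, k)) <->
    (forall i, (i < t.+1)%N -> b i = c i).
Proof.
move=> hk h2; have n0 : (0 < n)%N by lia.
have rn : (2 ^ t %% n < n)%N by rewrite ltn_mod.
pose v := (2 ^ t %% n < k)%N.
have [|c Hc] := @run_live_cylinder n t (k - v * (2 ^ t %% n)) _ n0.
  by rewrite /v; case: ltnP => ?; lia.
have [c' Hc'] := cylinder_extend t c v.
exists c' => b; rewrite -Hc' -Hc /= /v.
case: (runP b t n0) => [k' hk'|z hz].
  by rewrite step_halted; split=> [[? []]//|[[]]]; lia.
rewrite step_live //; last by case/andP: hz.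
rewrite h2; move: hz.
case: (b t) => hz; rewrite ?mul1n ?mul0n ?addn0;
  case: leqP => ?; case: ltnP => ?; split=> [[[]]|[[]]] *;
  repeat split; try congr pair; try (by case; lia); lia.
Qed.

Lemma run_halts_early (n t k : nat) (b : nat -> bool) : (0 < n)%N ->
  (2 * (2 ^ t %% n) < n)%N -> run n b t.+1 = (n, k) -> run n b t = (n, k).
Proof.
move=> n0 h2 /=; case: (runP b t n0) => [k' _|z hz].
  by rewrite step_halted.
by rewrite step_live ?ltn_mod //; [rewrite leqNgt h2 => -[]; lia|case/andP: hz].
Qed.

(** * Probability of having halted with a given value after [t] flips *)

(** This is the form of the event to which [mutually_independent] applies. *)
Lemma cylinder_bigcap (T : Type) (B : nat -> T -> bool) (t : nat) (c : nat -> bool) :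
  [set w | forall i, (i < t)%N -> B i w = c i] =
  \bigcap_(i in [set` iota 0 t]) B i @^-1` [set c i].
Proof.
by apply/seteqP; split=> w /= h i; have := h i; rewrite /= mem_iota add0n.
Qed.

Lemma measurable_cylinder (d : measure_display) (T : measurableType d)
    (R : realType) (P : probability T R) (B : nat -> {RV P >-> bool})
    (t : nat) (c : nat -> bool) :
  measurable [set w | forall i, (i < t)%N -> B i w = c i].
Proof.
rewrite cylinder_bigcap; apply: fin_bigcap_measurable => [|i _].
  exact: finite_seq.
by rewrite -[X in measurable X]setTI; exact: measurable_funPT.
Qed.

Lemma probability_cylinder (d : measure_display) (T : measurableType d)
    (R : realType) (P : probability T R) (B : nat -> {RV P >-> bool})
    (t : nat) (c : nat -> bool) :
  mutually_independent B ->
  (forall (i : nat) (b : bool), P (B i @^-1` [set b]) = (2^-1 : R)%:E) ->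
  P [set w | forall i, (i < t)%N -> B i w = c i] = ((2 ^+ t)^-1)%:E.
Proof.
move=> B_indep B_fair; rewrite cylinder_bigcap B_indep ?iota_uniq //.
rewrite (eq_bigr (fun=> (2^-1 : R)%:E)) => [|i _]; last exact: B_fair.
by rewrite prodEFin big_const_seq count_predT size_iota iter_mulr_1 exprVn.
Qed.

(** By induction on [t]: if [n <= 2 * (2 ^ t %% n)], one disjoint cylinder of probability
    [2 ^- t.+1] joins the event, matching the increment of the quotient; otherwise the event does
    not change. Measurability is carried along because additivity needs it. *)
Lemma probability_halted (d : measure_display) (T : measurableType d)
    (R : realType) (P : probability T R) (n : nat) (B : nat -> {RV P >-> bool})
    (t k : nat) :
  mutually_independent B ->
  (forall (i : nat) (b : bool), P (B i @^-1` [set b]) = (2^-1 : R)%:E) ->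
  (1 <= k <= n)%N ->
  measurable [set w | run n (B ^~ w) t = (n, k)] /\
  P [set w | run n (B ^~ w) t = (n, k)] = ((2 ^ t %/ n)%:R / 2 ^+ t)%:E.
Proof.
move=> B_indep B_fair hk; have n0 : (0 < n)%N by lia.
elim: t => [|t [mH PH]] /=.
  have [n1|n1] := eqVneq n 1%N.
    have -> : k = 1%N by lia.
    rewrite n1 (_ : [set _ | _] = setT); last by apply/seteqP; split.
    by rewrite probability_setT expr0 divr1.
  rewrite (_ : [set _ | _] = set0).
    by rewrite measure0 expn0 divn_small ?mul0r //; lia.
  by apply/seteqP; split=> w //= -[] *; lia.
have [Eq _] := expn2S_divmod t n0.
have [n_le|lt_n] := leqP n (2 * (2 ^ t %% n)).
- have [c Hc] := run_halts_cylinder hk n_le.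
  rewrite (_ : [set _ | _] = [set w | run n (B ^~ w) t = (n, k)] `|`
    [set w | forall i, (i < t.+1)%N -> B i w = c i]); last first.
    apply/seteqP; split=> w /=.
      case: (pselect (run n (B ^~ w) t = (n, k))) => [|h] h'; first by left.
      by right; apply/(Hc (B ^~ w)).
    by case=> [->|/(Hc (B ^~ w))[]//]; rewrite step_halted.
  have mC := measurable_cylinder B t.+1 c.
  split; first exact: measurableU.
  rewrite measureU //; last first.
    by apply/seteqP; split=> w //= -[h /(Hc (B ^~ w))[_]].
  rewrite [X in (X + _)%E]PH [X in (_ + X)%E]probability_cylinder // -EFinD Eq n_le; congr EFin.
  by rewrite natrD natrM exprS /=; field; rewrite expf_neq0.
- rewrite (_ : [set _ | _] = [set w | run n (B ^~ w) t = (n, k)]); last first.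
    apply/seteqP; split=> w /=; first exact: (@run_halts_early _ _ _ (B ^~ w)).
    by move=> ->; rewrite step_halted.
  split=> //; rewrite PH Eq leqNgt lt_n addn0 natrM exprS; congr EFin.
  by field; rewrite expf_neq0.
Qed.

(** * Passage to the limit *)

Lemma cvg_divn_expn2 (R : realType) (n : nat) : (0 < n)%N ->
  ((2 ^ t %/ n)%:R / 2 ^+ t : R) @[t --> \oo] --> (n%:R^-1 : R).
Proof.
move=> n0; have n0R : (0 : R) < n%:R by rewrite ltr0n.
have half0 : ((2^-1 : R) ^+ t) @[t --> \oo] --> (0 : R).
  by apply: cvg_expr; rewrite ger0_norm ?invf_lt1 ?ltr1n.
(* With [q = 2 ^ t %/ n], the two bounds amount to [q * n <= 2 ^ t <= (q + 1) * n]. *)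
apply: (@squeeze_cvgr _ _ _ _ (fun t => n%:R^-1 - 2^-1 ^+ t) (fun=> n%:R^-1)).
- apply: nearW => t.
  have p0 : (0 : R) < 2 ^+ t by rewrite exprn_gt0.
  have := divn_eq (2 ^ t) n; have := ltn_pmod (2 ^ t) n0 => lt_n E.
  rewrite /= exprVn; apply/andP; split.
    rewrite lerBlDr -[X in _ + X]div1r -mulrDl ler_pdivlMr // mulrC.
    by rewrite ler_pdivrMr // natr1 -natrX -natrM ler_nat; lia.
  rewrite ler_pdivrMr // mulrC ler_pdivlMr //.
  by rewrite -natrX -natrM ler_nat; lia.
- by rewrite -[X in _ --> X]subr0; apply: cvgB => //; exact: cvg_cst.
- exact: cvg_cst.
Qed.

(** The event is the union over [t] of the events of having halted with [k] after [t] flips. These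
    increase, since halted states persist, so continuity from below applies. *)
Lemma probability_returns (d : measure_display) (T : measurableType d)
    (R : realType) (P : probability T R) (n : nat) (B : nat -> {RV P >-> bool})
    (k : nat) :
  mutually_independent B ->
  (forall (i : nat) (b : bool), P (B i @^-1` [set b]) = (2^-1 : R)%:E) ->
  (1 <= k <= n)%N ->
  measurable [set w | optimal_uniform_returns n (B ^~ w) k] /\
  P [set w | optimal_uniform_returns n (B ^~ w) k] = (n%:R^-1)%:E.
Proof.
move=> B_indep B_fair hk; have n0 : (0 < n)%N by lia.
pose H t := [set w | run n (B ^~ w) t = (n, k)].
have mPH t := @probability_halted _ _ _ _ n _ t _ B_indep B_fair hk.
have -> : [set w | optimal_uniform_returns n (B ^~ w) k] = \bigcup_t H t.
  apply/seteqP; split=> w /=; first by move=> /(returns_run _ _ n0)[t]; exists t.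
  by case=> t _ h; apply/returns_run => //; exists t.
have mH t : measurable (H t) by case: (mPH t).
have mU : measurable (\bigcup_t H t) by exact: bigcupT_measurable.
split=> //.
have H_mono : nondecreasing_seq H.
  by move=> t u tu; apply/subsetPset => w; exact: run_haltedW.
have /cvg_lim <- // := @nondecreasing_cvg_mu _ _ _ P _ mH mU H_mono.
apply/cvg_lim => //.
rewrite (_ : P \o H = EFin \o fun t => (2 ^ t %/ n)%:R / 2 ^+ t); last first.
  by apply/funext => t /=; case: (mPH t).
by apply: cvg_EFin; [exact: nearW|exact: cvg_divn_expn2].
Qed.

(** * Range and uniqueness of the output, and the uniform law *)

Lemma returns_range (n k : nat) (b : nat -> bool) : (0 < n)%N ->
  optimal_uniform_returns n b k -> (1 <= k <= n)%N.
Proof.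
move=> n0 /(returns_run _ _ n0)[t].
case: (runP b t n0) => [k' h [<-] //|x _ []].
by have := ltn_pmod (2 ^ t) n0; lia.
Qed.

Lemma returns_inj (n k l : nat) (b : nat -> bool) : (0 < n)%N ->
  optimal_uniform_returns n b k -> optimal_uniform_returns n b l -> k = l.
Proof.
move=> n0 /(returns_run _ _ n0)[t Et] /(returns_run _ _ n0)[u Eu].
have := run_haltedW (leq_maxl t u) Et.
by rewrite (run_haltedW (leq_maxr t u) Eu) => -[].
Qed.

Theorem theorem1 (d : measure_display) (T : measurableType d) (R : realType)
  (P : probability T R) (n : nat) (hn : (1 <= n)%N)
  (B : nat -> {RV P >-> bool})
  (B_indep : mutually_independent B)
  (B_fair : forall (i : nat) (b : bool),
     P (B i @^-1` [set b]) = (2^-1 : R)%:E) :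
  (forall k : nat,
     measurable [set w : T | optimal_uniform_returns n (fun i => B i w) k]) /\
  P [set w : T | exists k : nat,
       optimal_uniform_returns n (fun i => B i w) k] = 1%:E /\
  (forall k : nat,
     P [set w : T | optimal_uniform_returns n (fun i => B i w) k] =
       (if (1 <= k <= n)%N then (n%:R^-1 : R) else 0)%:E).
Proof.
have mPret k := @probability_returns _ _ _ _ n _ k B_indep B_fair.
have ret0 k : ~~ (1 <= k <= n)%N ->
    [set w : T | optimal_uniform_returns n (fun i => B i w) k] = set0.
  by move=> hk; apply/seteqP; split=> w //= /(returns_range hn); apply/negP.
split; [|split].
- by move=> k; have [/mPret[]//|/ret0->] := boolP (1 <= k <= n)%N.
(* Almost sure termination follows from the law of the output: halting is the disjoint union of the
   [n] events [F i], each of probability [1 / n]. The shift [i.+1] maps the ordinals below [n] onto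
   the values from 1 to [n]. *)
- pose F i := [set w | optimal_uniform_returns n (B ^~ w) i.+1].
  have hF (i : 'I_n) : (1 <= i.+1 <= n)%N by rewrite /= ltn_ord.
  rewrite (_ : [set _ | _] = \big[setU/set0]_(i < n) F i); last first.
    rewrite -bigcup_mkord; apply/seteqP; split=> w /= [k]; last by exists k.+1.
    by case: k => [|k] ret; have := returns_range hn ret => // kn; exists k.
  rewrite measure_bigsetU_ord //; first last.
  + apply/trivIsetP => i j _ _ /eqP ij; apply/seteqP; split=> w //= -[hi hj].
    by apply: ij; apply: val_inj; case: (returns_inj hn hi hj).
  + by move=> i; case: (mPret _ (hF i)).
  rewrite (eq_bigr (fun=> (n%:R^-1 : R)%:E)) => [|i _].
    by rewrite sumEFin sumr_const card_ord -(mulr_natr n%:R^-1) mulVf // pnatr_eq0 -lt0n.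
  by case: (mPret _ (hF i)).
- move=> k; have [hk|hk] := boolP (1 <= k <= n)%N; first by case: (mPret k hk).
  by rewrite ret0 // measure0.
Qed.
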